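(* Let $p$ be a prime, and let $c\in\mathbb{N}$, $d\in\mathbb{N}^{*}$ with $\gcd(c,p)=1$, $\gcd(d,p)=1$ and $\gcd(c,d)=1$. Define sequences $(\alpha_i)_{i\ge 0}$ and $(\beta_i)_{i\ge 0}$ by $$\beta_0=c,\qquad \alpha_i=\beta_i d^{-1}\bmod p\ \ (i\ge 0),\qquad \beta_{i+1}=\frac{\beta_i-\alpha_i d}{p}\in\mathbb{Z}\ \ (i\ge 0).$$ Then: (1) If $c<d$, then $0\le|\beta_i|<d$ for all $i\in\mathbb{N}$. (2) Suppose $c>d$ and $p\ge 3$. (2.1) If $0<\frac{c(p-1)}{2dp}<1$, then $|\beta_i|<d$ for all $i\in\mathbb{N}^{*}$. (2.2) If $1<\frac{c(p-1)}{2dp}$, let $m=\left\lfloor \dfrac{\log\left(\frac{c(p-1)}{2dp}\right)}{\log p}\right\rfloor$. Then $d<|\beta_i|\le c$ for $0\le i<m+1$; $0\le|\beta_i|<d$ for $i>m+1$; and $0\le|\beta_i|<c$ for $i=m+1$.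
   Context: For an integer $b$ and an integer $d$ coprime to $p$, the notation $b\,d^{-1}\bmod p$ denotes the unique element of $\{0,1,\dots,p-1\}$ congruent modulo $p$ to $b\cdot d'$, where $d'$ is an inverse of $d$ modulo $p$. $\lfloor x\rfloor$ denotes the integer part of $x$. *)

(* Defs.v *)
From HB Require Import structures.
From mathcomp Require Import all_boot all_order all_algebra.
Set Implicit Arguments.
Unset Strict Implicit.
Unset Printing Implicit Defensive.
Import Order.TTheory GRing.Theory Num.Theory.
Local Open Scope ring_scope.

(* [b d^-1 mod p]: the first Bezout coefficient of [egcdn d p] is an inverse of
   [d] modulo [p] when [d] is positive and coprime to [p]; the choice of the
   inverse is irrelevant, see [divmodpE]. *)
Definition divmodp (p : nat) (b : int) (d : nat) : int :=
  ((b * (egcdn d p).1%:Z) %% p%:Z)%Z.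

(* The integer division by [p] is exact, see [beta_seqS]. *)
Fixpoint beta_seq (p c d i : nat) : int :=
  if i is j.+1 then
    ((beta_seq p c d j - divmodp p (beta_seq p c d j) d * d%:Z) %/ p%:Z)%Z
  else c%:Z.

Definition alpha_seq (p c d i : nat) : int := divmodp p (beta_seq p c d i) d.

Lemma egcdn_inv (p d : nat) : (0 < d)%N -> coprime d p ->
  (d%:Z * (egcdn d p).1%:Z = 1 %[mod p%:Z])%Z.
Proof.
move=> d0 /eqP cdp; case: (egcdnP p d0) => u v e _ /=.
by rewrite -PoszM mulnC e cdp PoszD PoszM modzMDl.
Qed.

Lemma divmodp_bounds (p : nat) (b : int) (d : nat) : prime p ->
  0 <= divmodp p b d < p%:Z.
Proof.
move=> /prime_gt0 p0; apply/andP; split; first by apply: modz_ge0; case: p p0.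
by apply: ltz_pmod.
Qed.

Lemma divmodp_mul (p : nat) (b : int) (d : nat) : (0 < d)%N -> coprime d p ->
  (divmodp p b d * d%:Z = b %[mod p%:Z])%Z.
Proof.
move=> d0 cdp; rewrite /divmodp modzMml -mulrA [_ * d%:Z]mulrC.
by rewrite -modzMmr egcdn_inv // modzMmr mulr1.
Qed.

Lemma divmodpE (p : nat) (b : int) (d : nat) (d' : int) :
  (0 < d)%N -> coprime d p -> (d%:Z * d' = 1 %[mod p%:Z])%Z ->
  divmodp p b d = ((b * d') %% p%:Z)%Z.
Proof.
move=> d0 cdp hd'; rewrite -[in RHS]modzMml -(divmodp_mul b d0 cdp) modzMml.
by rewrite -mulrA -modzMmr hd' modzMmr mulr1 /divmodp modz_mod.
Qed.

Lemma beta_seqS (p c d i : nat) : (0 < d)%N -> coprime d p ->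
  beta_seq p c d i.+1 * p%:Z = beta_seq p c d i - alpha_seq p c d i * d%:Z.
Proof.
move=> d0 cdp; apply/divzK.
by rewrite -eqz_mod_dvd; apply/eqP/esym/divmodp_mul.
Qed.

(* Main.v *)
(** Since 0 <= alpha_i <= p - 1, unrolling p beta_(i+1) = beta_i - alpha_i d
    gives c - d (p^i - 1) <= beta_i p^i <= c. Also beta_i > - d for all i, and
    the property beta_i < d persists once it holds. When p >= 3 it holds as soon
    as c (p - 1) < 2 d p^i, while it fails if 2 d p^(i+1) <= c (p - 1). The
    floor of the logarithm only locates c (p - 1) / (2 d) between consecutive
    powers of p. *)
Require Import Defs.
From HB Require Import structures.
From mathcomp Require Import all_boot all_order all_algebra.
From mathcomp Require Import ring zify.
From mathcomp Require Import reals exp.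
Set Implicit Arguments.
Unset Strict Implicit.
Unset Printing Implicit Defensive.
Import Order.TTheory GRing.Theory Num.Theory.
Local Open Scope ring_scope.

Lemma beta_seqS_bounds (p c d i : nat) :
    prime p -> (0 < d)%N -> coprime d p ->
  beta_seq p c d i.+1 * p%:Z <= beta_seq p c d i
    <= beta_seq p c d i.+1 * p%:Z + (p%:Z - 1) * d%:Z.
Proof.
move=> pp d0 cdp; rewrite (beta_seqS c i d0 cdp) /alpha_seq.
have /andP[] := divmodp_bounds (beta_seq p c d i) d pp.
by move: (beta_seq p c d i) (divmodp p _ d) => b a a0 ap; apply/andP; nia.
Qed.

(** The errors telescope: the step from [i] to [i.+1] adds at most d (p - 1) p^i, and d (p^i - 1) +
    d (p - 1) p^i = d (p^(i+1) - 1). *)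
Lemma beta_seq_pow_bounds (p c d i : nat) :
    prime p -> (0 < d)%N -> coprime d p ->
  beta_seq p c d i * p%:Z ^+ i <= c%:Z
    <= beta_seq p c d i * p%:Z ^+ i + d%:Z * (p%:Z ^+ i - 1).
Proof.
move=> pp d0 cdp; elim: i => [|i /andP[IHl IHr]].
  by rewrite expr0 mulr1 subrr mulr0 addr0 lexx.
have /andP[] := beta_seqS_bounds c i pp d0 cdp.
have : 0 < p%:Z ^+ i by apply: exprn_gt0; have := prime_gt0 pp; lia.
rewrite exprS; move: IHl IHr.
move: (beta_seq p c d i) (beta_seq p c d i.+1) (p%:Z ^+ i) => b b' q.
by move=> *; apply/andP; nia.
Qed.

(** If beta_(i+1) <= - d, then beta_i <= - d p + (p - 1) d = - d, so a violation would propagate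
    back to beta_0 = c >= 0. *)
Lemma beta_seq_gtN (p c d i : nat) : prime p -> (0 < d)%N -> coprime d p ->
  - d%:Z < beta_seq p c d i.
Proof.
move=> pp d0 cdp; elim: i => [|i]; first by rewrite /=; lia.
have /andP[_] := beta_seqS_bounds c i pp d0 cdp.
have := prime_gt0 pp.
by move: (beta_seq p c d i) (beta_seq p c d i.+1) => b b' *; nia.
Qed.

Lemma normr_beta_seq_lt (p c d i j : nat) :
    prime p -> (0 < d)%N -> coprime d p -> (i <= j)%N ->
  beta_seq p c d i < d%:Z -> `|beta_seq p c d j| < d%:Z.
Proof.
move=> pp d0 cdp lij bi; rewrite ltr_norml beta_seq_gtN //=.
rewrite -(subnKC lij); elim: (j - i)%N => [|k]; first by rewrite addn0.
have /andP[+ _] := beta_seqS_bounds c (i + k) pp d0 cdp.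
rewrite addnS; have := prime_gt0 pp.
by move: (beta_seq p c d (i + k)) (beta_seq p c d (i + k).+1) => b b' *; nia.
Qed.

Lemma beta_seq_lt_start (p c d i : nat) :
    prime p -> (0 < d)%N -> coprime d p -> (0 < c)%N -> (0 < i)%N ->
  beta_seq p c d i < c%:Z.
Proof.
move=> pp d0 cdp c0 i0; have /andP[+ _] := beta_seq_pow_bounds c i pp d0 cdp.
have : 1 < p%:Z ^+ i.
  by rewrite exprn_egt1 -?lt0n //; have := prime_gt1 pp; lia.
by move: (beta_seq p c d i) (p%:Z ^+ i) => b q *; nia.
Qed.

Lemma beta_seq_lt_modulus (p c d i : nat) :
    prime p -> (0 < d)%N -> coprime d p -> (3 <= p)%N ->
  c%:Z * (p%:Z - 1) < 2 * d%:Z * p%:Z ^+ i -> beta_seq p c d i < d%:Z.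
Proof.
move=> pp d0 cdp p3; have /andP[+ _] := beta_seq_pow_bounds c i pp d0 cdp.
have : 0 < p%:Z ^+ i by apply: exprn_gt0; lia.
move: (beta_seq p c d i) (p%:Z ^+ i) => b q q0 lbc lc.
rewrite ltNge; apply/negP => ldb.
have ldq : d%:Z * q <= c%:Z by apply: le_trans lbc; rewrite ler_pM2r.
(* Here p >= 3 enters, as 2 <= p - 1. *)
have : d%:Z * q * 2 <= c%:Z * (p%:Z - 1) by apply: ler_pM => //; nia.
by nia.
Qed.

Lemma beta_seq_gt_modulus (p c d i : nat) :
    prime p -> (0 < d)%N -> coprime d p ->
  2 * d%:Z * p%:Z ^+ i.+1 <= c%:Z * (p%:Z - 1) -> d%:Z < beta_seq p c d i.
Proof.
move=> pp d0 cdp; have /andP[_] := beta_seq_pow_bounds c i pp d0 cdp.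
have p1 := prime_gt1 pp.
have : 0 < p%:Z ^+ i by apply: exprn_gt0; lia.
rewrite exprS; move: (beta_seq p c d i) (p%:Z ^+ i) => b q q0 lcb lc.
rewrite ltNge; apply/negP => lbd.
(* With beta_i <= d the lower bound gives c <= d q + d (q - 1). Multiplying by p - 1 < p then
   contradicts 2 d p q <= c (p - 1). *)
have lcq : c%:Z <= 2 * d%:Z * q by nia.
have : c%:Z * (p%:Z - 1) <= 2 * d%:Z * q * (p%:Z - 1) by apply: ler_wpM2r; lia.
have : 0 < 2 * d%:Z * q by nia.
by nia.
Qed.

Lemma floor_log_bounds (R : realType) (p : nat) (x : R) :
    (1 < p)%N -> 1 <= x ->
  exists n : nat, Num.floor (ln x / ln p%:R) = n%:Z /\
    p%:R ^+ n <= x < p%:R ^+ n.+1.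
Proof.
move=> p1 x1; have x0 : 0 < x by apply: lt_le_trans x1.
have p0 : 0 < p%:R :> R by rewrite ltr0n ltnW.
have lnp : 0 < ln (p%:R : R) by rewrite ln_gt0 // ltr1n.
(* Nonnegativity, due to 1 <= x, lets the floor be replaced by a natural exponent. *)
have : 0 <= Num.floor (ln x / ln p%:R).
  by rewrite floor_ge0 divr_ge0 ?(ltW lnp) ?ln_ge0.
case E: (Num.floor _) => [n|//] _; exists n; split=> //.
have := floor_itv (ln x / ln p%:R); rewrite E intrD -!pmulrn mulr1n natr1.
by rewrite ler_pdivlMr // ltr_pdivrMr // !mulr_natl -!lnXn // ler_ln ?ltr_ln
  ?posrE ?exprn_gt0.
Qed.

Theorem mainTheorem2 (R : realType) (p c d : nat) (p_prime : prime p)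
    (d_gt0 : (0 < d)%N) (coprime_cp : coprime c p) (coprime_dp : coprime d p)
    (coprime_cd : coprime c d) :
  ((c < d)%N -> forall i : nat, 0 <= `|beta_seq p c d i| < d%:Z) /\
  ((d < c)%N -> (3 <= p)%N ->
   let x : R := c%:R * (p%:R - 1) / (2 * d%:R * p%:R) in
   (0 < x < 1 -> forall i : nat, (0 < i)%N -> `|beta_seq p c d i| < d%:Z) /\
   (1 < x ->
    let m : int := Num.floor (ln x / ln p%:R) in
    [/\ forall i : nat, 0 <= i%:Z < m + 1 ->
          d%:Z < `|beta_seq p c d i| <= c%:Z,
        forall i : nat, m + 1 < i%:Z -> 0 <= `|beta_seq p c d i| < d%:Z
      & forall i : nat, i%:Z = m + 1 -> 0 <= `|beta_seq p c d i| < c%:Z])).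
Proof.
have p1 := prime_gt1 p_prime.
split=> [lcd i|ldc p3 x].
  by rewrite normr_ge0 (@normr_beta_seq_lt p c d 0 i).
have c0 : (0 < c)%N by lia.
have den0 : 0 < 2 * d%:R * p%:R :> R by rewrite !mulr_gt0 ?ltr0n // ltnW.
(* The factor p in the denominator of [x] shifts the exponent: comparing [x] with p^n amounts to
   comparing the integers c (p - 1) and 2 d p^(n+1). *)
have denE n : p%:R ^+ n * (2 * d%:R * p%:R) =
    (2 * d%:Z * p%:Z ^+ n.+1)%:~R :> R.
  by rewrite !rmorphM rmorphXn /= -!pmulrn exprS; ring.
have numE : c%:R * (p%:R - 1) = (c%:Z * (p%:Z - 1))%:~R :> R.
  by rewrite rmorphM rmorphB /= -!pmulrn.
have x_ltX n : x < p%:R ^+ n ->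
    c%:Z * (p%:Z - 1) < 2 * d%:Z * p%:Z ^+ n.+1.
  by rewrite ltr_pdivrMr // denE numE ltr_int.
have x_geX n : p%:R ^+ n <= x ->
    2 * d%:Z * p%:Z ^+ n.+1 <= c%:Z * (p%:Z - 1).
  by rewrite ler_pdivlMr // denE numE ler_int.
split=> [/andP[_ x1] i i0|x1].
  (* Since x < p^0, the criterion already holds at index 1, and the bound persists from there. *)
  apply: (normr_beta_seq_lt p_prime d_gt0 coprime_dp i0).
  by apply: beta_seq_lt_modulus => //; apply: x_ltX; rewrite expr0.
have [n [-> /andP[pn_le lt_pn]]] := floor_log_bounds p1 (ltW x1).
split=> i.
- move=> /andP[_ lin].
  have ldb : d%:Z < beta_seq p c d i.
    apply: beta_seq_gt_modulus => //; apply: x_geX; apply: le_trans pn_le.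
    by rewrite ler_eXn2l ?ltr1n //; lia.
  rewrite gtr0_norm; last by lia.
  (* Equality with [c] occurs at index 0; later terms are strictly smaller. *)
  rewrite ldb /=; case: i {lin ldb} => [//|i].
  by rewrite ltW // beta_seq_lt_start.
- move=> lni; rewrite normr_ge0 /=.
  (* By the same shift, x < p^(n+1) yields the criterion at [n.+2], the first index beyond m + 1. *)
  apply: (@normr_beta_seq_lt p c d n.+2) => //; first by lia.
  by apply: beta_seq_lt_modulus => //; apply: x_ltX.
(* At index m + 1 neither comparison with [d] is available; what remains is - c < - d < beta_i <
   c. *)
- move=> ein; rewrite normr_ge0 ltr_norml /= beta_seq_lt_start //; last by lia.
  by rewrite andbT; have := beta_seq_gtN c i p_prime d_gt0 coprime_dp; lia.
Qed.
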